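(* Let $q=2$, let $p\ge1$ be real, let $N$ be a positive integer, and let $\hat{\mathbf Q},\mathbf Q\in\mathbb R^N$ be non-constant vectors (so that $\hat b\ne0$ and $b\neq 0$). Let $\hat{\mathbf S},\mathbf S$ be the normalized vectors, and let $\hat b$ be the centered norm of $\hat{\mathbf Q}$, as defined in the context. Let $l$ be the Norm-in-Norm loss with parameters $p$ and $q=2$. Assume that $\mathbf s\mapsto\frac1c\sum_{i=1}^N|s_i-S_i|^p$ is twice differentiable at $\mathbf s=\hat{\mathbf S}$. Let $\mathbf g=\frac{\partial l}{\partial\hat{\mathbf S}}$ and $\mathbf H=\frac{\partial^2 l}{\partial\hat{\mathbf S}^2}$ be its gradient and Hessian there. Let $\mathbf g_n=\frac{\partial l}{\partial\hat{\mathbf Q}}$ and $\mathbf H_n=\frac{\partial^2 l}{\partial\hat{\mathbf Q}^2}$ be the gradient and Hessian of $\hat{\mathbf Q}\mapsto l(\hat{\mathbf Q},\mathbf Q)$ (with $\mathbf Q$ fixed). Then $$\mathbf g_n^T\mathbf H_n\mathbf g_n=\frac1{\hat b^2}\left\{\mathbf g_n^T\mathbf H\mathbf g_n-\langle\mathbf g,\hat{\mathbf S}\rangle\|\mathbf g_n\|^2\right\}.$$ Further, when $p=2$, one has $\mathbf g=\frac2c(\hat{\mathbf S}-\mathbf S)$ and $\mathbf H=\frac2c\mathbf I$, where $\mathbf I$ is the identity matrix of order $N$, and $$\mathbf g_n^T\mathbf H_n\mathbf g_n=\frac1{\hat b^4}\left\{\mathbf g^T\mathbf H\mathbf g-\frac2c\left(1-\langle\mathbf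 S,\hat{\mathbf S}\rangle\right)\left[\frac4{c^2}\left(1-\langle\mathbf S,\hat{\mathbf S}\rangle\right)+\|\mathbf g\|^2-\langle\mathbf g,\hat{\mathbf S}\rangle^2\right]\right\}.$$
   Context: Norm-in-Norm loss with parameters $p,q\ge 1$. For $\hat{\mathbf Q}=(\hat Q_1,\dots,\hat Q_N)$ (predicted scores) and $\mathbf Q=(Q_1,\dots,Q_N)$ (subjective scores) in $\mathbb R^N$, set $$\hat a=\frac1N\sum_{i=1}^N\hat Q_i,\quad \hat b=\Big(\sum_{i=1}^N|\hat Q_i-\hat a|^q\Big)^{1/q},\quad a=\frac1N\sum_{i=1}^N Q_i,\quad b=\Big(\sum_{i=1}^N|Q_i-a|^q\Big)^{1/q},$$ $$\hat S_i=\frac{\hat Q_i-\hat a}{\hat b},\qquad S_i=\frac{Q_i-a}{b}\qquad(i=1,\dots,N),$$ with $\hat{\mathbf S}=(\hat S_1,\dots,\hat S_N)$ and $\mathbf S=(S_1,\dots,S_N)$. The loss is $$l(\hat{\mathbf Q},\mathbf Q)=\frac1c\sum_{i=1}^N|\hat S_i-S_i|^p,\qquad c=\begin{cases}2^pN^{1-p/q}& p<q,\\ 2^p& p\ge q.\end{cases}$$ Here $\hat a,\hat b,\hat{\mathbf S}$ are regarded as functions of $\hat{\mathbf Q}$, while $\frac{\partial l}{\partial\hat{\mathbf S}}$ and $\frac{\partial^2 l}{\partial\hat{\mathbf S}^2}$ denote the gradient and Hessian of the expression $\frac1c\sum_i|s_i-S_i|^p$ with respect to $\mathbf s$, evaluated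 at $\mathbf s=\hat{\mathbf S}$. Vectors in quadratic forms are treated as column vectors. $\langle\cdot,\cdot\rangle$ is the Euclidean inner product, and $\|\cdot\|$ is the Euclidean norm. *)

(* Defs.v *)
From HB Require Import structures.
From mathcomp Require Import all_boot all_order all_algebra.
From mathcomp Require Import all_classical all_reals all_analysis.
Set Implicit Arguments.
Unset Strict Implicit.
Unset Printing Implicit Defensive.
Import Order.TTheory GRing.Theory Num.Theory.
Import numFieldNormedType.Exports.
Local Open Scope classical_set_scope.
Local Open Scope ring_scope.

Section Euclidean.
Variables (R : realType) (N : nat).
Implicit Types (u v : 'cV[R]_N) (A : 'M[R]_N).

Definition inner u v : R := \sum_i u i 0 * v i 0.

(* The library's norm `|u| on matrices is the sup norm, hence this definition. *)
Definition enorm u : R := Num.sqrt (inner u u).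

Definition quadform A u : R := (u^T *m A *m u) 0 0.

End Euclidean.

Section Derivatives.
Variables (R : realType) (N : nat).
Implicit Types (f : 'cV[R]_N -> R) (x : 'cV[R]_N).

(* [delta_mx i 0] is the i-th vector of the canonical basis, so that
   ['D_(delta_mx i 0) f] is the i-th partial derivative of [f]. *)
Definition gradient f x : 'cV[R]_N := \col_i 'D_(delta_mx i 0) f x.

Definition hessian f x : 'M[R]_N :=
  \matrix_(i, j) 'D_(delta_mx i 0) ('D_(delta_mx j 0) f) x.

(* Frechet differentiability; the sup norm and the Euclidean norm being
   equivalent, [differentiable] does not depend on the choice between them.
   The derivative of [f] is represented by its gradient. *)
Definition twice_differentiable f x : Prop :=
  (\forall y \near x, differentiable f y) /\ differentiable (gradient f) x.

End Derivatives.

Section NormInNorm.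
Variables (R : realType) (N : nat).
Implicit Types (p q : R) (Q Qh S s : 'cV[R]_N).

Definition nonconstant Q : Prop := exists i j, Q i 0 != Q j 0.

Definition mean Q : R := (\sum_i Q i 0) / N%:R.

Definition centered_norm q Q : R :=
  (\sum_i `|Q i 0 - mean Q| `^ q) `^ q^-1.

Definition normalized q Q : 'cV[R]_N :=
  \col_i ((Q i 0 - mean Q) / centered_norm q Q).

Definition nin_const p q : R :=
  if p < q then 2 `^ p * N%:R `^ (1 - p / q) else 2 `^ p.

(* The loss as a function of the normalized predicted scores [s]. *)
Definition nin_score_loss p q S s : R :=
  (nin_const p q)^-1 * \sum_i `|s i 0 - S i 0| `^ p.

Definition nin_loss p q Qh Q : R :=
  nin_score_loss p q (normalized q Q) (normalized q Qh).

End NormInNorm.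

Arguments nin_const {R} N p q.

(* Main.v *)
(* With P the projection onto the vectors of mean 0, the normalization is
   x |-> P x / |P x|, whose derivative at x is v |-> (P v - <Sh, v> Sh) / bh
   with Sh = P x / bh a unit vector fixed by P. Hence
     gn = (P g - <g, Sh> Sh) / bh,
   so that P gn = gn and <Sh, gn> = 0. When this formula is differentiated
   in the direction gn, the derivative of 1 / bh therefore vanishes and Sh
   varies by gn / bh; pairing with gn removes every multiple of Sh, and only
   (<gn, H gn> - <g, Sh> |gn|^2) / bh^2 remains. *)

Require Import Defs.
From HB Require Import structures.
From mathcomp Require Import all_boot all_order all_algebra.
From mathcomp Require Import all_classical all_reals all_analysis.
From mathcomp Require Import ring.
Import Order.TTheory GRing.Theory Num.Theory.
Import numFieldNormedType.Exports.
Local Open Scope classical_set_scope.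
Local Open Scope ring_scope.

(** A derivative depends only on the germ of the function. This is needed because the closed formula
    for the gradient of the loss holds only near the point. *)
Lemma near_eq_is_diff {R : numFieldType} {V W : normedModType R}
    (f g df : V -> W) (x : V) :
  (\near x, f x = g x) -> is_diff x f df -> is_diff x g df.
Proof.
move=> fg [dfx dfE].
have gE : g \o shift x = cst (g x) + 'd f x +o_ 0 id.
  apply/eqaddoP => _/posnumP[e].
  have /eqaddoP/(_ e%:num) := diff_locally dfx.
  move=> He.
  have fgx : f x = g x by exact: nbhs_singleton fg.
  have {}fg : \forall h \near (0 : V), f (h + x) = g (h + x).
    by move: fg; rewrite (near_shift 0 x) /= subr0.
  apply: filterS2 fg (He _) => // h fgh /=.
  by rewrite !fctE /= fgh fgx.
have dg : 'd g x = 'd f x :> (V -> W).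
  by apply: diff_unique => //; exact: diff_continuous.
apply: DiffDef; last by rewrite dg.
apply/diff_locallyP; rewrite dg; split => //; exact: diff_continuous.
Qed.

(** * Calculus rules for Fréchet derivatives *)

Section IsDiff.
Context {R : realType} {V : normedModType R}.

Lemma is_diff_derive {W : normedModType R} (f df : V -> W) (x v : V) :
  is_diff x f df -> 'D_v f x = df v.
Proof. by case=> dfx <-; rewrite deriveE. Qed.

Lemma is_diff_sum {W : normedModType R} n (f df : 'I_n -> V -> W) (x : V) :
  (forall i, is_diff x (f i) (df i)) ->
  is_diff x (fun y => \sum_i f i y) (fun v => \sum_i df i v).
Proof.
move=> dfx.
rewrite (_ : (fun y => _) = \sum_i f i); last first.
  by apply/funext => y; rewrite fct_sumE.
rewrite (_ : (fun v => _) = \sum_i df i); last first.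
  by apply/funext => y; rewrite fct_sumE.
elim/big_ind2 : _ => [|f1 df1 f2 df2 ? ?|i _]; last exact: dfx.
- exact: is_diff_cst.
- exact: is_diffD.
Qed.

(** Expansion in the canonical basis reduces a vector-valued map to a sum of scalar functions times
    fixed vectors. *)
Lemma is_diff_col n (f df : V -> 'cV[R]_n) (x : V) :
  (forall i, is_diff x (fun y => f y i 0) (fun v => df v i 0)) ->
  is_diff x f df.
Proof.
move=> dfx.
have colE (u : 'cV[R]_n) : u = \sum_i u i 0 *: delta_mx i 0.
  by rewrite {1}(matrix_sum_delta u); apply: eq_bigr => i _; rewrite big_ord1.
rewrite (_ : f = fun y => \sum_i f y i 0 *: delta_mx i 0); last first.
  by apply/funext => y; exact: colE.
rewrite (_ : df = fun y => \sum_i df y i 0 *: delta_mx i 0); last first.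
  by apply/funext => y; exact: colE.
apply: is_diff_sum => i.
exact: (is_diff_comp (dfx i) (is_diff_scalel _ _)).
Qed.

Lemma is_diffV (f df : V -> R) (x : V) : is_diff x f df -> f x != 0 ->
  is_diff x (fun y => (f y)^-1) (fun v => - (f x)^-2 * df v).
Proof.
move=> [dfx dfE] fx0; apply: DiffDef; first exact: differentiableV.
by rewrite diffV // dfE.
Qed.

Lemma is_diff_sqrt (f df : V -> R) (x : V) : is_diff x f df -> 0 < f x ->
  is_diff x (fun y => Num.sqrt (f y))
    (fun v => (2 * Num.sqrt (f x))^-1 * df v).
Proof.
move=> dfx fx0; have dsqrt := is_derive1_sqrt fx0.
have ds : differentiable (@Num.sqrt R) (f x) by apply/derivable1_diffP.
have := is_diff_comp dfx (differentiableP ds).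
move/is_diff_eq; apply; apply/funext => v /=; rewrite diff1E // derive1E derive_val.
exact: mulrC.
Qed.

End IsDiff.

Lemma is_diff_linear {R : realType} {W : normedModType R} n
  (f : {linear 'cV[R]_n -> W}) (x : 'cV[R]_n) : is_diff x f f.
Proof.
(* Finite dimension gives continuity: [f] is a finite sum of coordinates times the fixed vectors
   [f (delta_mx i 0)]. *)
have fc : continuous f.
  move=> y; apply: differentiable_continuous.
  rewrite (_ : (f : _ -> _) = fun u => \sum_i u i 0 *: f (delta_mx i 0)).
    have [] // : is_diff y (fun u => \sum_i u i 0 *: f (delta_mx i 0))
     (fun v => \sum_i ('d (fun u => u i 0 : R) y v) *: f (delta_mx i 0)).
    apply: is_diff_sum => i.
    exact: (is_diff_comp (differentiableP (differentiable_coord y i 0))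
             (is_diff_scalel _ _)).
  apply/funext => u; rewrite {1}(matrix_sum_delta u) linear_sum.
  by apply: eq_bigr => i _; rewrite big_ord1 linearZ.
by apply: DiffDef; [exact: linear_differentiable | exact: diff_lin].
Qed.

Lemma is_diff_coord {R : realType} {V : normedModType R} n
  (f df : V -> 'cV[R]_n) (x : V) i : is_diff x f df ->
  is_diff x (fun y => f y i 0) (fun v => df v i 0).
Proof.
move=> dfx; pose coord (u : 'cV[R]_n) : R := u i 0.
have coord_lin : linear coord by move=> a u w; rewrite /coord !mxE.
pose coordM := GRing.isLinear.Build _ _ _ _ _ coord_lin.
pose coordL : {linear _ -> _} := HB.pack coord coordM.
exact: (is_diff_comp dfx (is_diff_linear _ coordL _)).
Qed.

Lemma is_diffZ_fun {R : realType} {V : normedModType R} n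
  (k dk : V -> R) (f df : V -> 'cV[R]_n) (x : V) :
  is_diff x k dk -> is_diff x f df ->
  is_diff x (fun y => k y *: f y) (fun v => k x *: df v + dk v *: f x).
Proof.
move=> dkx dfx; apply: is_diff_col => i.
rewrite (_ : (fun y => _) = k * (fun y => f y i 0)); last first.
  by apply/funext => y; rewrite mxE.
have := is_diffM dkx (is_diff_coord _ _ _ _ i dfx).
move/is_diff_eq; apply; apply/funext => v; rewrite !mxE.
by congr (_ + _); exact: mulrC.
Qed.

(** * Euclidean inner product, gradient and Hessian *)

Section Inner.
Context {R : realType} {n : nat}.
Implicit Types (u v w : 'cV[R]_n) (k : R).

Lemma innerC u v : inner u v = inner v u.
Proof. by apply: eq_bigr => i _; rewrite mulrC. Qed.

Lemma innerDr u v w : inner u (v + w) = inner u v + inner u w.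
Proof. by rewrite -big_split; apply: eq_bigr => i _; rewrite mxE mulrDr. Qed.

Lemma innerZr k u v : inner u (k *: v) = k * inner u v.
Proof. by rewrite mulr_sumr; apply: eq_bigr => i _; rewrite mxE mulrCA. Qed.

Lemma innerNr u v : inner u (- v) = - inner u v.
Proof. by rewrite -scaleN1r innerZr mulN1r. Qed.

Lemma innerBr u v w : inner u (v - w) = inner u v - inner u w.
Proof. by rewrite innerDr innerNr. Qed.

Lemma innerZl k u v : inner (k *: u) v = k * inner u v.
Proof. by rewrite innerC innerZr innerC. Qed.

Lemma innerBl u v w : inner (u - v) w = inner u w - inner v w.
Proof. by rewrite innerC innerBr ![inner w _]innerC. Qed.

Lemma inner_delta u i : inner u (delta_mx i 0) = u i 0.
Proof.
rewrite /inner (bigD1 i) //= big1 => [|j ji]; rewrite !mxE ?eqxx ?mulr1 ?addr0 //.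
by rewrite (negbTE ji) mulr0.
Qed.

Lemma inner_ge0 u : 0 <= inner u u.
Proof. by apply: sumr_ge0 => i _; rewrite -expr2 sqr_ge0. Qed.

Lemma inner_eq0 u : (inner u u == 0) = (u == 0).
Proof.
apply/eqP/eqP => [u0|->]; last by rewrite /inner big1 // => i _; rewrite mxE mul0r.
apply/colP => i; rewrite mxE; apply/eqP.
have /eqP := u0; rewrite psumr_eq0 => [/allP/(_ i)|j _]; last first.
  by rewrite -expr2 sqr_ge0.
by rewrite mem_index_enum => /(_ isT); rewrite mulf_eq0 orbb.
Qed.

Lemma enorm_sqr u : enorm u ^+ 2 = inner u u.
Proof. by rewrite sqr_sqrtr // inner_ge0. Qed.

Lemma is_diff_inner {V : normedModType R} (f df g dg : V -> 'cV[R]_n) (x : V) :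
  is_diff x f df -> is_diff x g dg ->
  is_diff x (fun y => inner (f y) (g y))
    (fun h => inner (df h) (g x) + inner (f x) (dg h)).
Proof.
move=> dfx dgx.
have := is_diff_sum _ _ _ _ (fun i => is_diffM
  (is_diff_coord _ _ _ _ i dfx) (is_diff_coord _ _ _ _ i dgx)).
move/is_diff_eq; apply; apply/funext => v; rewrite -big_split /=.
by apply: eq_bigr => i _; rewrite addrC; congr (_ + _); exact: mulrC.
Qed.

(** Linearity of the differential on the canonical basis makes it the pairing with the vector of
    partial derivatives, so chain rules become inner product computations. *)
Lemma is_diff_gradient (f : 'cV[R]_n -> R) (x : 'cV[R]_n) :
  differentiable f x -> is_diff x f (inner (gradient f x)).
Proof.
move=> dfx; apply: is_diff_eq (differentiableP dfx) _; apply/funext => v.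
rewrite {1}(matrix_sum_delta v) linear_sum; apply: eq_bigr => i _.
by rewrite big_ord1 linearZ /= mxE deriveE // mulrC.
Qed.

Lemma is_diff_gradientE (f : 'cV[R]_n -> R) (x : 'cV[R]_n) (u : 'cV[R]_n) :
  is_diff x f (inner u) -> gradient f x = u.
Proof.
by move=> dfx; apply/colP => i; rewrite mxE (is_diff_derive _ _ _ _ dfx) inner_delta.
Qed.

Lemma hessianE (f : 'cV[R]_n -> R) (df : 'cV[R]_n -> 'cV[R]_n)
    (x : 'cV[R]_n) i j :
  is_diff x (gradient f) df -> hessian f x i j = df (delta_mx i 0) j 0.
Proof.
move=> dgx.
have := is_diff_derive _ _ _ (delta_mx i 0) (is_diff_coord _ _ _ _ j dgx).
by rewrite mxE => <-; congr ('D_ _ _ _); apply/funext => y; rewrite mxE.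
Qed.

(** Linearity of [df] collapses the double sum of Hessian entries, so the form is read off from one
    directional derivative of the gradient. *)
Lemma quadform_hessian (f : 'cV[R]_n -> R) (df : 'cV[R]_n -> 'cV[R]_n)
    (x v : 'cV[R]_n) :
  is_diff x (gradient f) df -> quadform (hessian f x) v = inner v (df v).
Proof.
move=> dgx; rewrite /quadform mxE; apply: eq_bigr => j _; rewrite mulrC.
congr (_ * _); have -> : df v = \sum_i v i 0 *: df (delta_mx i 0).
  case: dgx => _ <-; rewrite {1}(matrix_sum_delta v) linear_sum.
  by apply: eq_bigr => i _; rewrite big_ord1 linearZ.
by rewrite mxE summxE; apply: eq_bigr => i _; rewrite (hessianE _ _ _ _ _ dgx) !mxE.
Qed.

End Inner.

(** * The centering projection P and the normalization for q = 2 *)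

Definition center {R : realType} {n : nat} (u : 'cV[R]_n) : 'cV[R]_n :=
  \col_i (u i 0 - mean u).

Section Center.
Context {R : realType} {n : nat}.
Implicit Types (u v : 'cV[R]_n).

Fact center_is_linear : linear (@center R n).
Proof.
move=> k u v; apply/colP => i; rewrite !mxE.
have -> : mean (k *: u + v) = k * mean u + mean v.
  rewrite /mean mulrA mulr_sumr -mulrDl -big_split /=; congr (_ / _).
  by apply: eq_bigr => j _; rewrite !mxE.
by ring.
Qed.

HB.instance Definition _ :=
  GRing.isLinear.Build R 'cV[R]_n 'cV[R]_n *:%R center center_is_linear.

Lemma is_diff_center u : is_diff u center center.
Proof. exact: is_diff_linear. Qed.

(** The correction subtracted from the inner product of [u] and [v] is the product of their
    coordinate sums divided by [n], which is symmetric. *)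
Lemma center_selfadjoint u v : inner (center u) v = inner u (center v).
Proof.
rewrite /inner.
under eq_bigr do rewrite mxE mulrBl.
under [RHS]eq_bigr do rewrite mxE mulrBr.
rewrite !sumrB -mulr_sumr -mulr_suml; congr (_ - _).
by rewrite /mean; ring.
Qed.

Lemma mean_center u : mean (center u) = 0.
Proof.
rewrite {1}/mean; under eq_bigr do rewrite mxE.
rewrite sumrB sumr_const card_ord -[_ *+ n]mulr_natr.
(* For [n = 0] the mean is 0 by the convention on division by zero. *)
have [n0|n0] := eqVneq (n%:R : R) 0; first by rewrite n0 invr0 mulr0.
by rewrite /mean divfK // subrr mul0r.
Qed.

Lemma centerK u : center (center u) = center u.
Proof. by apply/colP => i; rewrite [LHS]mxE mean_center subr0. Qed.

Lemma centered_norm2E u :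
  centered_norm 2 u = Num.sqrt (inner (center u) (center u)).
Proof.
rewrite /centered_norm powR12_sqrt; last by apply: sumr_ge0 => i _; exact: powR_ge0.
congr Num.sqrt; apply: eq_bigr => i _.
by rewrite mxE powR_mulrn // real_normK ?num_real // expr2.
Qed.

Lemma centered_norm2_gt0 u :
  (0 < centered_norm 2 u) = (0 < inner (center u) (center u)).
Proof. by rewrite centered_norm2E sqrtr_gt0. Qed.

(** If the centered vector vanished, every coordinate would equal the mean. *)
Lemma nonconstant_norm_gt0 u : nonconstant u -> 0 < centered_norm 2 u.
Proof.
move=> [i [j uij]]; rewrite centered_norm2_gt0 lt0r inner_ge0 andbT inner_eq0.
apply: contra uij => /eqP/colP cu0.
have := cu0 i; have := cu0 j; rewrite !mxE => /subr0_eq -> /subr0_eq ->.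
by rewrite eqxx.
Qed.

Lemma normalized2E u : normalized 2 u = (centered_norm 2 u)^-1 *: center u.
Proof. by apply/colP => i; rewrite !mxE mulrC. Qed.

Lemma center_normalized u : center (normalized 2 u) = normalized 2 u.
Proof. by rewrite normalized2E linearZ /= centerK. Qed.

Lemma inner_normalized u : 0 < centered_norm 2 u ->
  inner (normalized 2 u) (normalized 2 u) = 1.
Proof.
move=> u0; rewrite normalized2E innerZl innerZr mulrA -invfM -expr2.
rewrite {1}centered_norm2E sqr_sqrtr ?inner_ge0 // mulVf //.
by rewrite gt_eqF // -centered_norm2_gt0.
Qed.

Lemma is_diff_inner_center u :
  is_diff u (fun y => inner (center y) (center y))
    (fun v => inner (center u) v *+ 2).
Proof.
have := is_diff_inner _ _ _ _ _ (is_diff_center u) (is_diff_center u).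
move/is_diff_eq; apply; apply/funext => v.
by rewrite [inner (center v) _]innerC -center_selfadjoint centerK mulr2n.
Qed.

Lemma near_centered_norm2_gt0 u : 0 < centered_norm 2 u ->
  \forall y \near u, 0 < centered_norm 2 y.
Proof.
move=> u0; rewrite centered_norm2_gt0 in u0.
have [/differentiable_continuous cu _] := is_diff_inner_center u.
apply: filterS (cvgr_gt _ cu _ u0) => y.
by rewrite centered_norm2_gt0.
Qed.

(** The gradient of the norm |P u| is the unit vector P u / |P u|: the 2 from the square cancels the
    2 from the square root. *)
Lemma is_diff_centered_norm2 u : 0 < centered_norm 2 u ->
  is_diff u (centered_norm 2) (inner (normalized 2 u)).
Proof.
move=> u0; have u0' := u0; rewrite centered_norm2_gt0 in u0'.
rewrite (_ : centered_norm 2 = fun y => Num.sqrt (inner (center y) (center y))).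
  have := is_diff_sqrt _ _ _ (is_diff_inner_center u) u0'.
  move/is_diff_eq; apply; apply/funext => v.
  rewrite -centered_norm2E normalized2E innerZl.
  by field; rewrite gt_eqF.
by apply/funext => y; exact: centered_norm2E.
Qed.

Lemma is_diff_inv_centered_norm2 u : 0 < centered_norm 2 u ->
  is_diff u (fun y => (centered_norm 2 y)^-1)
    (fun v => - (centered_norm 2 u)^-2 * inner (normalized 2 u) v).
Proof.
move=> u0; apply: is_diffV; first exact: is_diff_centered_norm2.
by rewrite gt_eqF.
Qed.

Lemma is_diff_normalized2 u : 0 < centered_norm 2 u ->
  is_diff u (normalized 2) (fun v => (centered_norm 2 u)^-1 *:
    (center v - inner (normalized 2 u) v *: normalized 2 u)).
Proof.
move=> u0.
have := is_diffZ_fun _ _ _ _ _ _ (is_diff_inv_centered_norm2 _ u0)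
  (is_diff_center u).
rewrite (_ : (fun y => (centered_norm 2 y)^-1 *: center y) = normalized 2);
  last by apply/funext => y; rewrite normalized2E.
move/is_diff_eq; apply; apply/funext => v.
(* Naming the scalar shields the normalized vector inside it from the unfolding that follows. *)
set k := inner _ v.
rewrite normalized2E scalerBr !scalerA -scaleNr -exprVn.
by congr (_ + _ *: _); ring.
Qed.

End Center.

(** * First and second derivatives of a function composed with the normalization *)

Section Composition.
Context {R : realType} {n : nat} (F : 'cV[R]_n -> R).
Implicit Types (x u v y : 'cV[R]_n).

(** The derivative of the normalization is a self-adjoint operator, so in the chain rule it can be
    moved from the direction onto the gradient of [F]. *)
Lemma is_diff_comp_normalized2 y : 0 < centered_norm 2 y ->
  differentiable F (normalized 2 y) ->
  is_diff y (F \o normalized 2) (inner ((centered_norm 2 y)^-1 *: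
    (center (gradient F (normalized 2 y)) -
     inner (gradient F (normalized 2 y)) (normalized 2 y) *: normalized 2 y))).
Proof.
move=> y0 dF.
have := is_diff_comp (is_diff_normalized2 _ y0) (is_diff_gradient _ _ dF).
move/is_diff_eq; apply; apply/funext => v /=.
rewrite innerZl innerZr innerBl innerBr innerZl innerZr center_selfadjoint.
by rewrite [_ * inner _ v]mulrC.
Qed.

Variable x : 'cV[R]_n.
Hypotheses (x0 : 0 < centered_norm 2 x)
  (dF : twice_differentiable F (normalized 2 x)).

Local Notation b := (centered_norm 2 x).
Local Notation S := (normalized 2 x).
Local Notation g := (gradient F S).
Local Notation gn := (gradient (F \o normalized 2) x).

Lemma gradient_comp_normalized2 :
  gn = b^-1 *: (center g - inner g S *: S).
Proof.
apply: is_diff_gradientE; apply: is_diff_comp_normalized2 => //.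
exact: nbhs_singleton dF.1.
Qed.

(** Differentiating the gradient once more requires its formula on a whole neighbourhood; continuity
    of the normalization pulls back the one where [F] is differentiable. *)
Lemma near_diff_comp_normalized2 : \forall y \near x,
  0 < centered_norm 2 y /\ differentiable F (normalized 2 y).
Proof.
have [/differentiable_continuous cS _] := is_diff_normalized2 _ x0.
have nF := cS _ dF.1.
by near=> y; split; near: y; [exact: near_centered_norm2_gt0|exact: nF].
Unshelve. all: by end_near. Qed.

(** Product rule on the closed formula: [dS] and [dg] are the variations of the normalized vector
    and of the gradient of [F], and the last summand comes from the factor 1 / b. *)
Lemma is_diff_gradient_comp_normalized2 :
  is_diff x (gradient (F \o normalized 2)) (fun v =>
   let dS := b^-1 *: (center v - inner S v *: S) in
   let dg := 'd (gradient F) S dS in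
   b^-1 *: (center dg - (inner g S *: dS + (inner dg S + inner g dS) *: S))
   + (- b^-2 * inner S v) *: (center g - inner g S *: S)).
Proof.
have dS := is_diff_normalized2 _ x0.
have dg := is_diff_comp dS (differentiableP dF.2).
apply: (near_eq_is_diff (fun y => (centered_norm 2 y)^-1 *:
    (center (gradient F (normalized 2 y)) -
     inner (gradient F (normalized 2 y)) (normalized 2 y) *: normalized 2 y))).
  apply: filterS near_diff_comp_normalized2 => y [y0 dFy].
  by apply/esym/is_diff_gradientE; exact: is_diff_comp_normalized2.
apply: is_diffZ_fun (is_diff_inv_centered_norm2 _ x0) _.
apply: is_diffB.
  exact: (is_diff_comp dg (is_diff_center _)).
by apply: is_diffZ_fun => //; exact: is_diff_inner.
Qed.

Lemma twice_differentiable_comp_normalized2 :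
  twice_differentiable (F \o normalized 2) x.
Proof.
split; last by case: is_diff_gradient_comp_normalized2.
apply: filterS near_diff_comp_normalized2 => y [y0 dFy].
by case: (is_diff_comp_normalized2 _ y0 dFy).
Qed.

Lemma center_gradient_comp_normalized2 : center gn = gn.
Proof.
by rewrite gradient_comp_normalized2 linearZ /= linearB linearZ /= centerK
  center_normalized.
Qed.

(* Scale invariance of the normalization: the loss is constant along the ray
   through the centered vector. *)
Lemma inner_normalized_gradient : inner S gn = 0.
Proof.
rewrite gradient_comp_normalized2 innerZr innerBr innerZr inner_normalized //.
by rewrite -center_selfadjoint center_normalized mulr1 innerC subrr mulr0.
Qed.

Lemma quadform_hessian_comp_normalized2 :
  quadform (hessian (F \o normalized 2) x) gn =
  1 / b ^+ 2 * (quadform (hessian F S) gn - inner g S * enorm gn ^+ 2).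
Proof.
have gS := inner_normalized_gradient; have gC := center_gradient_comp_normalized2.
have Hn := quadform_hessian _ _ x gn is_diff_gradient_comp_normalized2.
rewrite [LHS]Hn {Hn} enorm_sqr.
have -> := quadform_hessian _ _ _ gn (differentiableP dF.2).
(* In the direction [gn], [dS] becomes [gn] divided by b, and the variation of 1 / b is zero. *)
cbv zeta; rewrite gS gC scale0r subr0 mulr0 scale0r addr0.
(* From here on, only the mean zero of [gn] and its orthogonality to [S] matter. *)
move: gn gS gC => w gS gC.
rewrite innerZr innerBr -center_selfadjoint gC innerDr !innerZr linearZ /= innerZr.
rewrite [inner w S]innerC gS mulr0 addr0.
by field; rewrite gt_eqF.
Qed.

End Composition.

(** * The squared loss, p = 2 *)

Section SquareLoss.
Context {R : realType} {n : nat}.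
Implicit Types (s S u : 'cV[R]_n).
Local Notation c := (@nin_const R n 2 2).

Lemma is_diff_score_loss2 S s :
  is_diff s (nin_score_loss 2 2 S) (inner ((2 / c) *: (s - S))).
Proof.
have ds : is_diff s (fun y => y - S) id.
  by have := is_diffB (is_diff_id s) (is_diff_cst S s); rewrite subr0.
have := is_diffZ c^-1 (is_diff_inner _ _ _ _ _ ds ds).
(* With exponent 2 the absolute value disappears, and the score loss is the inner square of [y - S]
   divided by c. *)
rewrite (_ : _ *: _ = nin_score_loss 2 2 S); last first.
  apply/funext => y; rewrite /nin_score_loss; congr (_ * _).
  apply: eq_bigr => i _; rewrite !mxE powR_mulrn //.
  by rewrite real_normK ?num_real // expr2.
move/is_diff_eq; apply; apply/funext => v.
rewrite innerZl -[LHS]/(c^-1 * (inner v (s - S) + inner (s - S) v)).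
by rewrite [inner v _]innerC; ring.
Qed.

Lemma gradient_score_loss2 S :
  gradient (nin_score_loss 2 2 S) = fun s => (2 / c) *: (s - S).
Proof. apply/funext => s; exact: is_diff_gradientE (is_diff_score_loss2 S s). Qed.

Lemma hessian_score_loss2 S s :
  hessian (nin_score_loss 2 2 S) s = (2 / c) *: 1%:M.
Proof.
have dg : is_diff s (gradient (nin_score_loss 2 2 S)) ( *:%R (2 / c)).
  rewrite gradient_score_loss2.
  have := is_diffZ (2 / c) (is_diffB (is_diff_id s) (is_diff_cst S s)).
  by rewrite subr0.
apply/matrixP => i j; rewrite (hessianE _ _ _ _ _ dg) !mxE andbT.
by rewrite eq_sym.
Qed.

Lemma quadform_scalar (k : R) u : quadform (k *: 1%:M) u = k * inner u u.
Proof.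
rewrite /quadform -scalemxAr mulmx1 -scalemxAl mxE [in LHS]mxE.
by congr (_ * _); apply: eq_bigr => i _; rewrite mxE.
Qed.

End SquareLoss.

Theorem theorem2 (R : realType) (N : nat) (p : R) (Qh Q : 'cV[R]_N)
    (hN : (0 < N)%N) (hp : 1 <= p)
    (hQh : nonconstant Qh) (hQ : nonconstant Q) :
  let c := nin_const N p 2 in
  let bh := centered_norm 2 Qh in
  let Sh := normalized 2 Qh in
  let S := normalized 2 Q in
  twice_differentiable (nin_score_loss p 2 S) Sh ->
  let g := gradient (nin_score_loss p 2 S) Sh in
  let H := hessian (nin_score_loss p 2 S) Sh in
  let gn := gradient (fun x => nin_loss p 2 x Q) Qh in
  let Hn := hessian (fun x => nin_loss p 2 x Q) Qh in
  [/\ twice_differentiable (fun x => nin_loss p 2 x Q) Qh,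
      quadform Hn gn =
        1 / bh ^+ 2 * (quadform H gn - inner g Sh * enorm gn ^+ 2)
    & p = 2 ->
      [/\ g = (2 / c) *: (Sh - S),
          H = (2 / c) *: 1%:M
        & quadform Hn gn =
            1 / bh ^+ 4 *
            (quadform H g -
             2 / c * (1 - inner S Sh) *
             (4 / c ^+ 2 * (1 - inner S Sh) + enorm g ^+ 2
              - inner g Sh ^+ 2))]].
Proof.
move=> c bh Sh S dF g H gn Hn.
have b0 : 0 < bh by exact: nonconstant_norm_gt0.
have Hquad : quadform Hn gn =
    1 / bh ^+ 2 * (quadform H gn - inner g Sh * enorm gn ^+ 2).
  (* By definition the loss is the score loss composed with the normalization. *)
  exact: quadform_hessian_comp_normalized2.
split=> //; first exact: twice_differentiable_comp_normalized2.
move=> p2; have gE : g = (2 / c) *: (Sh - S).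
  by rewrite /g /c p2 gradient_score_loss2.
have HE : H = (2 / c) *: 1%:M by rewrite /H /c p2 hessian_score_loss2.
split; [exact: gE|exact: HE|].
(* Since p = q, the constant falls in the branch 2^p, which is positive. *)
have c0 : c != 0 by rewrite /c p2 /nin_const ltxx gt_eqF // powR_gt0.
have SS : inner Sh Sh = 1 by exact: inner_normalized.
have SC : center S = S by exact: center_normalized.
have ShC : center Sh = Sh by exact: center_normalized.
have gnE : gn = bh^-1 *: (center g - inner g Sh *: Sh).
  exact: gradient_comp_normalized2.
(* What remains is algebra from the recorded identities. *)
clearbody Hn gn H g S Sh bh c.
have gS : inner g Sh = 2 / c * (1 - inner S Sh).
  by rewrite gE innerZl innerBl SS.
(* Both score vectors have mean zero, so [g] does too and P disappears from the formula for [gn]. *)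
have gC : center g = g by rewrite gE linearZ /= linearB /= SC ShC.
rewrite Hquad HE !quadform_scalar !enorm_sqr.
(* Pythagoras: up to the factor 1 / bh, [gn] is the component of [g] orthogonal to the unit vector
   [Sh]. *)
have -> : inner gn gn = (inner g g - inner g Sh ^+ 2) / bh ^+ 2.
  rewrite gnE gC innerZl innerZr !innerBl !innerBr !innerZl !innerZr SS.
  by rewrite [inner Sh g]innerC; field; rewrite gt_eqF.
(* With t for the pairing of [g] and [Sh], and G for the squared norm of [g], both sides times bh^4
   are (2/c - t)(G - t^2); the term 4/c^2 (1 - <S, Sh>) is (2/c) t. *)
by rewrite gS; field; rewrite c0 gt_eqF.
Qed.
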